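(* For $n\ge 1$ let $\Gamma_n$ be the directed multigraph whose vertices are the isomorphism classes of connected cubic graphs on $2n$ vertices, with one directed edge from $[g]$ to $[w(g)]$ for every edge $\varepsilon$ of $g$ and each of the two Whitehead moves $w=w^{(1)}_\varepsilon, w^{(2)}_\varepsilon$ on $\varepsilon$. Then $\Gamma_n$ is connected for every $n\ge1$, and $\phi_{out}(\Gamma_n)\to 0$ as $n\to\infty$. Consequently, $\{\Gamma_n\}_{n\in\mathbb N}$ is not a family of outer--expanders.
   Context: A cubic graph is a finite graph in which every vertex has degree $3$; multiple edges and loops are allowed (a loop contributes $2$ to the degree). Whitehead moves: let $\varepsilon$ be a non-loop edge of a cubic graph $g$ with endpoints $u\neq v$. Besides the half-edge of $\varepsilon$, $u$ carries two half-edges $h_a,h_b$ and $v$ carries two half-edges $h_c,h_d$. The Whitehead move $w^{(1)}_\varepsilon$ detaches $h_b$ from $u$ and $h_c$ from $v$ and reattaches $h_c$ to $u$ and $h_b$ to $v$ (so afterwards $u$ carries $h_a,h_c$ and $v$ carries $h_b,h_d$, and $\varepsilon$ still joins $u,v$); $w^{(2)}_\varepsilon$ analogously makes $u$ carry $h_a,h_d$ and $v$ carry $h_b,h_c$. If $\varepsilon$ is a loop, both Whitehead moves on $\varepsilon$ are defined to leave $g$ unchanged (so they produce loops in $\Gamma_n$). Thus every vertex of $\Gamma_n$ has out-degree $2\cdot 3n=6n$. For a directed multigraph $G$ and $S\subseteq V(G)$, let $d(S)=\sum_{v\in S}\deg_{out}(v)$ and let $\partial(S)$ be the set of directed edges $(u,v)$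 with $u\in S$, $v\notin S$. For nonempty proper $S$, the outer-conductance is $\phi_{out}(S)=|\partial(S)|/\min\{d(S),d(V(G)\setminus S)\}$, and $\phi_{out}(G)=\min_S\phi_{out}(S)$. A sequence of directed graphs $G_n$ (with out- and in-degrees growing with the number of vertices) is an outer--expander family if $\phi_{out}(G_n)$ is bounded away from $0$ uniformly in $n$. *)

(* Defs.v *)
From HB Require Import structures.
From mathcomp Require Import all_classical all_reals all_analysis.
From mathcomp Require Import all_boot all_order all_algebra all_fingroup.
From mathcomp Require Import generic_quotient.

Set Implicit Arguments.
Unset Strict Implicit.
Unset Printing Implicit Defensive.

Import Order.TTheory GRing.Theory Num.Theory.

Local Open Scope nat_scope.

Record dimultigraph := DiMultigraph {
  node : finType;
  arc : finType;
  src : arc -> node;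
  tgt : arc -> node }.

Definition arc_rel (G : dimultigraph) : rel (node G) :=
  fun x y => [exists a : arc G, (src a == x) && (tgt a == y)].

(* Nonempty, and every vertex can be reached from every other one along a
   directed path (hence the underlying undirected graph is connected too). *)
Definition di_connected (G : dimultigraph) : Prop :=
  0 < #|node G| /\ forall x y : node G, connect (@arc_rel G) x y.

Definition outdeg (G : dimultigraph) (x : node G) : nat :=
  #|[set a : arc G | src a == x]|.

Definition outvol (G : dimultigraph) (S : {set node G}) : nat :=
  \sum_(x in S) outdeg x.

Definition out_boundary (G : dimultigraph) (S : {set node G}) : {set arc G} :=
  [set a : arc G | (src a \in S) && (tgt a \notin S)].

Definition set_conductance (R : realType) (G : dimultigraph)
    (S : {set node G}) : R :=
  (#|out_boundary S|%:R / (minn (outvol S) (outvol (~: S)))%:R)%R.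

(* The minimum is taken in the extended reals, so that it is +oo (and not some
   real junk value) for a digraph with fewer than two vertices. *)
Definition conductance (R : realType) (G : dimultigraph) : \bar R :=
  (\big[Order.min/+oo]_(S : {set node G} |
      (S != set0) && (S != [set: node G]))
     (set_conductance R S)%:E)%E.

Definition outer_expander_family (R : realType) (G : nat -> dimultigraph) :
    Prop :=
  exists2 c : R, (0 < c)%R & forall n, (c%:E <= conductance R (G n))%E.

(* [m] vertices and [k] half-edges: [att h] is the vertex carrying [h], and
   [mate h] is the other half of the edge containing [h]. *)
Record hgraph (m k : nat) := HGraph {
  att : {ffun 'I_k -> 'I_m};
  mate : {ffun 'I_k -> 'I_k} }.

Definition hgraph_pair (m k : nat) (g : hgraph m k) := (att g, mate g).
Definition pair_hgraph (m k : nat)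
    (p : {ffun 'I_k -> 'I_m} * {ffun 'I_k -> 'I_k}) := HGraph p.1 p.2.
Lemma hgraph_pairK (m k : nat) :
  cancel (@hgraph_pair m k) (@pair_hgraph m k).
Proof. by case. Qed.

HB.instance Definition _ (m k : nat) :=
  Finite.copy (hgraph m k) (can_type (@hgraph_pairK m k)).

Definition mate_ok (m k : nat) (g : hgraph m k) : bool :=
  [forall h, (mate g (mate g h) == h) && (mate g h != h)].

(* A loop at [v] contributes both of its half-edges to the fiber over [v]. *)
Definition cubic (m k : nat) (g : hgraph m k) : bool :=
  [forall v, #|[set h | att g h == v]| == 3].

Definition adj (m k : nat) (g : hgraph m k) : rel 'I_m :=
  fun u v => [exists h, (att g h == u) && (att g (mate g h) == v)].

Definition hconnected (m k : nat) (g : hgraph m k) : bool :=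
  [forall u, forall v, connect (adj g) u v].

Definition hiso (m k : nat) : rel (hgraph m k) := fun g g' =>
  [exists s : {perm 'I_m}, exists t : {perm 'I_k}, forall h,
    (att g' (t h) == s (att g h)) && (mate g' (t h) == t (mate g h))].

(* A cubic graph on 2n vertices has exactly 6n half-edges. *)
Record cgraph (n : nat) := CGraph {
  cgval :> hgraph (2 * n) (6 * n);
  _ : [&& mate_ok cgval, cubic cgval & hconnected cgval] }.

HB.instance Definition _ (n : nat) := [isSub for @cgval n].
HB.instance Definition _ (n : nat) := [Finite of cgraph n by <:].

Definition cgiso (n : nat) : rel (cgraph n) := fun g g' => hiso g g'.

Lemma cgiso_refl (n : nat) : reflexive (@cgiso n).
Proof.
move=> g; apply/existsP; exists 1%g; apply/existsP; exists 1%g.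
by apply/forallP => h; rewrite !perm1 !eqxx.
Qed.

Lemma hiso_symW (m k : nat) (g g' : hgraph m k) : hiso g g' -> hiso g' g.
Proof.
case/existsP=> s /existsP[t /forallP H].
apply/existsP; exists s^-1%g; apply/existsP; exists t^-1%g.
apply/forallP => h; case/andP: (H (t^-1%g h)).
rewrite !permKV => /eqP Ha /eqP Hm.
by rewrite Ha Hm !permK !eqxx.
Qed.

Lemma cgiso_sym (n : nat) : symmetric (@cgiso n).
Proof. by move=> g g'; apply/idP/idP; apply: hiso_symW. Qed.

Lemma cgiso_trans (n : nat) : transitive (@cgiso n).
Proof.
move=> g2 g1 g3 /existsP[s /existsP[t /forallP H]].
move=> /existsP[s' /existsP[t' /forallP H']].
apply/existsP; exists (s * s')%g; apply/existsP; exists (t * t')%g.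
apply/forallP => h; rewrite !permM.
case/andP: (H h) => /eqP Ha /eqP Hm.
by case/andP: (H' (t h)) => /eqP -> /eqP ->; rewrite Ha Hm !eqxx.
Qed.

Canonical cgiso_equiv (n : nat) : equiv_rel (cgraph n) :=
  EquivRel (@cgiso n) (@cgiso_refl n) (@cgiso_sym n) (@cgiso_trans n).

Definition iso_class (n : nat) := {eq_quot (@cgiso_equiv n)}%qT.
HB.instance Definition _ (n : nat) :=
  EqQuotient.copy (iso_class n) {eq_quot (@cgiso_equiv n)}%qT.
HB.instance Definition _ (n : nat) := [Countable of iso_class n by <:%/].
HB.instance Definition _ (n : nat) : isFinite (iso_class n) :=
  CanIsFinite (@reprK _ (iso_class n)).

(* An edge [{h, mate h}] is encoded by its half-edge of smaller index. *)
Definition edge (m k : nat) (g : hgraph m k) : finType :=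
  {h : 'I_k | h < mate g h}.

(* The half-edges carried by the vertex of [e], other than [e] itself. *)
Definition others (m k : nat) (g : hgraph m k) (e : 'I_k) : seq 'I_k :=
  [seq h <- enum 'I_k | (att g h == att g e) && (h != e)].

Definition swap_att (m k : nat) (g : hgraph m k) (p q : 'I_k) : hgraph m k :=
  HGraph [ffun h => att g (tperm p q h)] (mate g).

(* With [others g e = [:: ha; hb]] and [others g (mate g e) = [:: hc; hd]], the
   move w^(1) ([second = false]) exchanges [hb] with [hc], and the move w^(2)
   ([second = true]) exchanges [hb] with [hd]. Naming the half-edges in another
   way only changes which of the two moves is called w^(1), up to isomorphism. *)
Definition whitehead (m k : nat) (g : hgraph m k) (e : 'I_k) (second : bool) :
    hgraph m k :=
  if att g e == att g (mate g e) then g else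
  swap_att g (nth e (others g e) 1) (nth e (others g (mate g e)) second).

Lemma size_others (m k : nat) (g : hgraph m k) (e : 'I_k) :
  cubic g -> size (others g e) = 2.
Proof.
move=> /forallP/(_ (att g e))/eqP; rewrite (cardsD1 e) inE eqxx => -[] H.
rewrite -[RHS]H cardE /enum_mem size_filter /others size_filter.
rewrite -enumT; apply: eq_count => h /=.
by rewrite !inE andbC.
Qed.

Lemma whitehead_cubic (m k : nat) (g : hgraph m k) e second :
  cubic g -> cubic (whitehead g e second).
Proof.
move=> cg; rewrite /whitehead; case: ifP => // _.
apply/forallP => v; set p := nth _ _ _; set q := nth _ _ _.
have -> : [set h | att (swap_att g p q) h == v] =
          tperm p q @^-1: [set h | att g h == v].
  by apply/setP => h; rewrite !inE ffunE.
by rewrite card_preimset; [exact: (forallP cg) | exact: perm_inj].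
Qed.

Lemma whitehead_connected (m k : nat) (g : hgraph m k) e second :
    mate_ok g -> cubic g -> hconnected g ->
  hconnected (whitehead g e second).
Proof.
move=> mg cg hg; rewrite /whitehead; case: ifPn => // ne.
set p := nth _ _ _; set q := nth _ _ _.
have mK h : mate g (mate g h) = h by case/andP: (forallP mg h) => /eqP.
have : p \in others g e by rewrite mem_nth // size_others.
rewrite mem_filter => /andP[/andP[/eqP pu pe] _].
have : q \in others g (mate g e) by rewrite mem_nth // size_others //; case: second @q.
rewrite mem_filter => /andP[/andP[/eqP qv qe] _].
set g' := swap_att g p q.
have att_neq x y : att g x != att g y -> x != y by apply: contraNneq => ->.
have att'e : att g' e = att g e.
  rewrite ffunE tpermD //; apply: att_neq.
  by rewrite qv eq_sym.
have att'm : att g' (mate g e) = att g (mate g e).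
  rewrite ffunE tpermD //; apply: att_neq.
  by rewrite pu.
have adjS : symmetric (adj g').
  suff W x y : adj g' x y -> adj g' y x by move=> x y; apply/idP/idP; apply: W.
  case/existsP=> h /andP[hx hy]; apply/existsP; exists (mate g h).
  by rewrite hy /= mK hx.
have conS := sym_connect_sym adjS.
have uv : connect (adj g') (att g e) (att g (mate g e)).
  apply: connect1; apply/existsP; exists e; apply/andP; split.
    by rewrite att'e.
  by apply/eqP; exact: att'm.
have step h : connect (adj g') (att g h) (att g' h).
  rewrite ffunE; case: tpermP => [->|->|_ _]; rewrite ?pu ?qv //.
  by rewrite conS.
apply/forallP => x; apply/forallP => y.
have := forallP (forallP hg x) y.
apply: connect_sub x y => x y /existsP[h /andP[/eqP <- /eqP <-]].
apply: connect_trans (step h) _.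
apply: connect_trans (_ : connect _ _ (att g' (mate g h))) _; last first.
  by rewrite conS step.
by apply: connect1; apply/existsP; exists h; rewrite !eqxx.
Qed.

Lemma whitehead_mate (m k : nat) (g : hgraph m k) e second :
  mate (whitehead g e second) = mate g.
Proof. by rewrite /whitehead; case: ifP. Qed.

Lemma cwhitehead_proof (n : nat) (g : cgraph n) e second :
  let g' := whitehead g e second in
  [&& mate_ok g', cubic g' & hconnected g'].
Proof.
case: g => g /= /and3P[mg cg hg].
have mg' : mate_ok (whitehead g e second) by rewrite /mate_ok whitehead_mate.
by apply/and3P; split;
  [exact: mg' | exact: whitehead_cubic | exact: whitehead_connected].
Qed.

Definition cwhitehead (n : nat) (g : cgraph n) (e : edge g) (second : bool) :
    cgraph n :=
  CGraph (cwhitehead_proof g (val e) second).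

(* The edges and moves are read off from a chosen representative of the class;
   an isomorphism of representatives matches the edges, and matches the pairs of
   moves on corresponding edges up to isomorphism of the results. *)
Definition edge_move (n : nat) (x : iso_class n) : finType :=
  (edge (repr x) * bool)%type.

Definition gamma_arc (n : nat) : finType := {x : iso_class n & edge_move x}.

Definition gamma_src (n : nat) (a : gamma_arc n) : iso_class n := tag a.

Definition gamma_tgt (n : nat) (a : gamma_arc n) : iso_class n :=
  (\pi_(iso_class n) (cwhitehead (tagged a).1 (tagged a).2))%qT.

Definition Gamma (n : nat) : dimultigraph :=
  {| node := iso_class n; arc := gamma_arc n;
     src := @gamma_src n; tgt := @gamma_tgt n |}.

(* Main.v *)
(** Every Whitehead move is, up to isomorphism, an exchange of two half-edges
    across an edge, and is undone by a Whitehead move on the same edge.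

    Connectivity: if an edge joins a non-final vertex of a simple path to a
    vertex outside the path, one move on it inserts that vertex into the path,
    so every class is joined to one with a Hamiltonian path.  Moves along such
    a path transpose adjacent half-edges not belonging to it, so any two
    arrangements of these half-edges on the path are joined as well.

    Conductance: let [c0] be the class of the necklace, a cycle of [n] double
    edges.  Reversing moves, a class with an arc into [c0] is obtained from the
    necklace by one move; rotating the necklace, there are at most 54 of them.
    In such a class, other than [c0] itself, the edge of the arc has an end on
    no double edge; this happens at no more than 4 vertices, hence for no more
    than 24 arcs.  So at most 54 * 24 = 6 * 216 arcs enter [c0], whereas its
    out-degree is [6 * n]: the complement of [c0] has conductance at most
    [216 / n]. *)

Require Import Defs.
From mathcomp Require Import all_classical all_reals all_analysis.
From mathcomp Require Import all_boot all_order all_algebra all_fingroup.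
From mathcomp Require Import generic_quotient zify.

Set Implicit Arguments.
Unset Strict Implicit.
Unset Printing Implicit Defensive.

Import Order.TTheory GRing.Theory Num.Theory numFieldNormedType.Exports.

Local Open Scope nat_scope.

(** * Isomorphisms and exchanges of half-edges *)

Definition wf_hgraph (m k : nat) (g : hgraph m k) : bool :=
  [&& mate_ok g, cubic g & hconnected g].

Definition hisom (m k : nat) (g g' : hgraph m k) (s : {perm 'I_m})
    (t : {perm 'I_k}) : Prop :=
  (forall h, att g' (t h) = s (att g h)) /\
  (forall h, mate g' (t h) = t (mate g h)).

Section HalfEdgeGraphs.
Variables m k : nat.
Implicit Types (g : hgraph m k) (h e p q : 'I_k) (s : {perm 'I_m}).
Implicit Types (t : {perm 'I_k}).

Lemma hisoP g g' : hiso g g' <-> exists s t, hisom g g' s t.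
Proof.
split.
  case/existsP=> s /existsP[t /forallP H]; exists s, t.
  by split=> h; case/andP: (H h) => /eqP ? /eqP ?.
case=> s [t [Ha Hm]]; apply/existsP; exists s; apply/existsP; exists t.
by apply/forallP => h; rewrite Ha Hm !eqxx.
Qed.

Lemma hiso_trans g1 g2 g3 : hiso g1 g2 -> hiso g2 g3 -> hiso g1 g3.
Proof.
move=> /hisoP[s1 [t1 [A1 B1]]] /hisoP[s2 [t2 [A2 B2]]].
apply/hisoP; exists (s1 * s2)%g, (t1 * t2)%g.
by split=> h; rewrite !permM ?A2 ?A1 ?B2 ?B1.
Qed.

Lemma hgraph_eq g g' : att g =1 att g' -> mate g = mate g' -> g = g'.
Proof.
by case: g g' => [a b] [a' b'] /= /ffunP -> ->.
Qed.

Lemma mateK g : mate_ok g -> involutive (mate g).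
Proof. by move=> /forallP H h; case/andP: (H h) => /eqP. Qed.

Lemma mate_neq g h : mate_ok g -> mate g h != h.
Proof. by move=> /forallP H; case/andP: (H h). Qed.

Lemma mate_eq g h h' : mate_ok g -> (mate g h == h') = (h == mate g h').
Proof. by move=> mg; rewrite (can2_eq (mateK mg) (mateK mg)). Qed.

Lemma hisom_mate_ok g g' s t : hisom g g' s t -> mate_ok g -> mate_ok g'.
Proof.
move=> [_ Hm] mg; apply/forallP => h'.
rewrite -[h'](permKV t); set h := _ h'.
by rewrite !Hm mateK // eqxx (inj_eq perm_inj) mate_neq.
Qed.

Lemma hisom_cubic g g' s t : hisom g g' s t -> cubic g -> cubic g'.
Proof.
move=> [Ha _] /forallP cg; apply/forallP => v.
have -> : [set h | att g' h == v] = t @: [set h | att g h == s^-1%g v].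
  apply/setP => h; rewrite -[h](permKV t) (mem_imset _ _ perm_inj) !inE Ha.
  by rewrite -{1}[v](permKV s) (inj_eq perm_inj).
by rewrite card_imset //; exact: perm_inj.
Qed.

Lemma hisom_hconnected g g' s t : hisom g g' s t -> hconnected g -> hconnected g'.
Proof.
move=> [Ha Hm] /forallP cg; apply/forallP => u; apply/forallP => v.
rewrite -[u](permKV s) -[v](permKV s).
have /connectP[r + ->] := forallP (cg (s^-1%g u)) (s^-1%g v).
elim: r (s^-1%g u) => [|y r IH] x /=; first by move=> _; rewrite connect0.
case/andP=> /existsP[h /andP[/eqP hx /eqP hy]] /IH; apply: connect_trans.
apply: connect1; apply/existsP; exists (t h).
by rewrite Hm !Ha hx hy !eqxx.
Qed.

Lemma hiso_wf g g' : hiso g g' -> wf_hgraph g -> wf_hgraph g'.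
Proof.
move=> /hisoP[s [t H]] /and3P[? ? ?]; apply/and3P; split.
- exact: hisom_mate_ok H _.
- exact: hisom_cubic H _.
- exact: hisom_hconnected H _.
Qed.

Lemma hisom_swap g g' s t p q :
  hisom g g' s t -> hisom (swap_att g p q) (swap_att g' (t p) (t q)) s t.
Proof.
move=> [Ha Hm]; split=> h //=; rewrite !ffunE.
by rewrite -Ha; congr (att g' _); rewrite -(inj_tperm _ _ _ (@perm_inj _ t)).
Qed.

Lemma swap_attC g p q : swap_att g p q = swap_att g q p.
Proof. by rewrite /swap_att tpermC. Qed.

Lemma swap_attK g p q : swap_att (swap_att g p q) p q = g.
Proof. by apply: hgraph_eq => // h; rewrite /= !ffunE tpermK. Qed.

Lemma swap_att_id g p q : att g p = att g q -> swap_att g p q = g.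
Proof.
by move=> E; apply: hgraph_eq => // h; rewrite /= ffunE; case: tpermP => [->|->|].
Qed.

(** The exchanges that realise Whitehead moves on the non-loop edge of [e], stated without the order
    of [others]. In this form they are preserved by isomorphisms, by undoing the move and by passing
    to the other half of [e]. *)
Definition slidable g e p q : Prop :=
  [/\ att g e != att g (mate g e), att g p = att g e, p != e,
      att g q = att g (mate g e) & q != mate g e].

Lemma att_swap g p q h :
  att g h != att g p -> att g h != att g q -> att (swap_att g p q) h = att g h.
Proof.
move=> hp hq; rewrite ffunE tpermD //; first by apply: contraNneq hp => ->.
by apply: contraNneq hq => ->.
Qed.

Lemma att_swapD g p q h :
  h != p -> h != q -> att (swap_att g p q) h = att g h.
Proof. by move=> hp hq; rewrite ffunE tpermD // eq_sym. Qed.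

(** Both halves of [e] stay in place while [p] and [q] trade ends, so the inverse exchange is again
    one across [e]. *)
Lemma slidable_swap g e p q : slidable g e p q ->
  slidable (swap_att g p q) e q p.
Proof.
move=> [ne pe pne qe qne].
have Ee : att (swap_att g p q) e = att g e.
  rewrite att_swapD 1?eq_sym //.
  by apply: contraNneq ne => E; rewrite -qe E.
have Em : att (swap_att g p q) (mate g e) = att g (mate g e).
  rewrite att_swapD //; last by rewrite eq_sym.
  by apply: contraNneq ne => E; rewrite E pe.
split; rewrite /= ?Ee ?Em //.
- by rewrite ffunE tpermR.
- by apply: contraNneq ne => E; rewrite -qe E.
- by rewrite ffunE tpermL.
- by apply: contraNneq ne => E; rewrite -E pe.
Qed.

Lemma slidableC g e p q : mate_ok g -> slidable g e p q -> slidable g (mate g e) q p.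
Proof. by move=> mg [? ? ? ? ?]; split; rewrite ?mateK // eq_sym. Qed.

Lemma hisom_slidable g g' s t e p q : hisom g g' s t ->
  slidable g e p q -> slidable g' (t e) (t p) (t q).
Proof.
move=> [Ha Hm] [ne pe pne qe qne].
by split; rewrite ?Hm ?Ha ?(inj_eq perm_inj) ?pe ?qe.
Qed.

Lemma mem_others g e h : (h \in others g e) = (att g h == att g e) && (h != e).
Proof. by rewrite mem_filter mem_enum andbT. Qed.

(* Exchanging the names of the two ends of [e] turns one swap into the other. *)
Lemma hiso_swap_complement g e a b c d : mate_ok g ->
  att g e != att g (mate g e) ->
  a != b -> c != d ->
  others g e =i [:: a; b] -> others g (mate g e) =i [:: c; d] ->
  hiso (swap_att g a c) (swap_att g b d).
Proof.
move=> mg ne nab ncd Ou Ov; apply/hisoP.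
have [ua ane] : att g a = att g e /\ a != e.
  by have := Ou a; rewrite mem_others !inE eqxx => /andP[/eqP].
have [ub bne] : att g b = att g e /\ b != e.
  by have := Ou b; rewrite mem_others !inE eqxx orbT => /andP[/eqP].
have [vc cne] : att g c = att g (mate g e) /\ c != mate g e.
  by have := Ov c; rewrite mem_others !inE eqxx => /andP[/eqP].
have [vd dne] : att g d = att g (mate g e) /\ d != mate g e.
  by have := Ov d; rewrite mem_others !inE eqxx orbT => /andP[/eqP].
exists (tperm (att g e) (att g (mate g e))), (tperm e (mate g e)).
split=> h /=; last first.
  case: (tpermP e) => [->|->|/eqP he /eqP hm]; rewrite ?mateK ?tpermR ?tpermL //.
  by rewrite tpermD // eq_sym ?mate_eq // ?mateK //.
have N (x y : 'I_k) : x != y -> ((x == y) = false) * ((y == x) = false).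
  by move=> /negPf xy; rewrite [y == x]eq_sym xy.
have D x y : att g x = att g e -> att g y = att g (mate g e) ->
    ((x == y) = false) * ((y == x) = false).
  by move=> X Y; apply: N; apply: contraNneq ne => E; rewrite -X -Y E.
(* These two tables decide every equality among the six half-edges at the ends of [e], so that the
   permutations can be evaluated on each of them. *)
have atE := (ua, ub, vc, vd, negPf ne, eq_sym (att g (mate g e)), eqxx).
have evE := (N _ _ ane, N _ _ bne, N _ _ cne, N _ _ dne, N _ _ nab, N _ _ ncd,
  (D a c ua vc, D a d ua vd, D b c ub vc, D b d ub vd),
  (D _ _ ua (erefl _), D _ _ ub (erefl _), D _ _ (erefl _) vc, D _ _ (erefl _) vd),
  D e (mate g e) (erefl _) (erefl _), eqxx).
rewrite !ffunE !permE /=.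
have [-> | he] := eqVneq h e; first by rewrite ?(evE, atE).
have [-> | hm] := eqVneq h (mate g e); first by rewrite ?(evE, atE).
have [-> | ha] := eqVneq h a; first by rewrite ?(evE, atE).
have [-> | hb] := eqVneq h b; first by rewrite ?(evE, atE).
have [-> | hc] := eqVneq h c; first by rewrite ?(evE, atE).
have [-> | hd] := eqVneq h d; first by rewrite ?(evE, atE).
have := Ou h; rewrite mem_others !inE (negPf ha) (negPf hb) he andbT => ->.
by have := Ov h; rewrite mem_others !inE (negPf hc) (negPf hd) hm andbT => ->.
Qed.

Lemma others_pair g e p : cubic g -> att g p = att g e -> p != e ->
  exists b, p != b /\ others g e =i [:: p; b].
Proof.
move=> cg pe pne; have := size_others e cg.
have : p \in others g e by rewrite mem_others pe eqxx.
have : uniq (others g e) by rewrite filter_uniq // enum_uniq.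
case: (others g e) => [|a [|b []]] //=; rewrite !inE andbT => nab.
case/orP=> /eqP -> _; first by exists b.
by exists a; split; [rewrite eq_sym | move=> x; rewrite !inE orbC].
Qed.

(** A Whitehead move always displaces the second entry of [others g e]. If that is [p], one of the
    two moves exchanges it with [q]; otherwise the complementary exchange displaces it and gives an
    isomorphic graph. *)
Lemma slide_whitehead g e p q : mate_ok g -> cubic g -> slidable g e p q ->
  exists i, hiso (swap_att g p q) (whitehead g e i).
Proof.
move=> mg cg [ne pe pne qe qne]; rewrite /whitehead (negPf ne).
have [b [npb Ou]] := others_pair cg pe pne.
have [d [nqd Ov]] := others_pair cg qe qne.
have HC := hiso_swap_complement mg ne npb nqd Ou Ov.
have refl g' : hiso g' g'.
  by apply/hisoP; exists 1%g, 1%g; split=> h; rewrite !perm1.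
have Ub : nth e (others g e) 1 \in [:: p; b].
  by rewrite -Ou mem_nth // size_others.
have Uv i : nth e (others g (mate g e)) (i : bool) \in [:: q; d].
  by rewrite -Ov mem_nth // size_others //; case: i.
have NV : nth e (others g (mate g e)) false != nth e (others g (mate g e)) true.
  by rewrite nth_uniq ?size_others // filter_uniq // enum_uniq.
have V q' : q' \in [:: q; d] -> exists i : bool, nth e (others g (mate g e)) i = q'.
  move: (Uv false) (Uv true) NV; rewrite !inE.
  case/orP=> /eqP E0; case/orP=> /eqP E1; rewrite ?E0 ?E1 ?eqxx // => _;
    case/orP=> /eqP ->; by [exists false | exists true].
move: Ub; rewrite !inE => /orP[] /eqP ->.
  by have [i iq] := V q (mem_head _ _); exists i; rewrite iq.
have [i id] : exists i : bool, nth e (others g (mate g e)) i = d.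
  by apply: V; rewrite !inE eqxx orbT.
by exists i; rewrite id.
Qed.

Lemma whitehead_slide g e (i : bool) : cubic g -> att g e != att g (mate g e) ->
  exists p q, slidable g e p q /\ whitehead g e i = swap_att g p q.
Proof.
move=> cg ne; rewrite /whitehead (negPf ne).
exists (nth e (others g e) 1), (nth e (others g (mate g e)) i); split=> //.
have : nth e (others g e) 1 \in others g e by rewrite mem_nth // size_others.
have : nth e (others g (mate g e)) i \in others g (mate g e).
  by rewrite mem_nth // size_others //; case: (i).
by rewrite !mem_others => /andP[/eqP ? ?] /andP[/eqP ? ?].
Qed.

Lemma slide_wf g e p q : wf_hgraph g -> slidable g e p q ->
  wf_hgraph (swap_att g p q).
Proof.
move=> /and3P[mg cg hg] sl.
have [i I] := slide_whitehead mg cg sl.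
apply: hiso_wf (hiso_symW I) _; apply/and3P; split.
- by rewrite /mate_ok whitehead_mate.
- exact: whitehead_cubic.
- exact: whitehead_connected.
Qed.

End HalfEdgeGraphs.

(** * Reachability in [Gamma] expressed on graphs *)

Section Linked.
Variable n : nat.
Local Open Scope quotient_scope.
Implicit Types (g : cgraph n) (x y : iso_class n).

Lemma cgraph_wf g : wf_hgraph g.
Proof. by case: g. Qed.

Lemma pi_iso g g' : hiso g g' -> \pi_(iso_class n) g = \pi_(iso_class n) g'.
Proof. by move=> I; apply/eqmodP. Qed.

Lemma iso_repr g : exists s t, hisom (repr (\pi_(iso_class n) g)) g s t.
Proof.
apply/hisoP; have : \pi_(iso_class n) (repr (\pi_(iso_class n) g)) = \pi g.
  by rewrite reprK.
by move/eqmodP.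
Qed.

Lemma cgval_cwhitehead g (e : edge g) i :
  cgval (cwhitehead e i) = whitehead g (val e) i.
Proof. by []. Qed.

Lemma arc_cwhitehead x (e : 'I_(6 * n)) (i : bool) g' :
  e < mate (repr x) e -> hiso g' (whitehead (repr x) e i) ->
  @arc_rel (Gamma n) x (\pi g').
Proof.
move=> lt I.
pose e' : edge (repr x) := exist _ e lt.
have E : cgval (cwhitehead e' i) = whitehead (repr x) e i.
  exact: cgval_cwhitehead.
rewrite -E in I; move: E I; set g'' := cwhitehead e' i => _ I.
apply/existsP; exists (Tagged (fun x => edge_move x) ((e', i) : edge_move x)).
rewrite /= /gamma_src /gamma_tgt /= eqxx /=; apply/eqP.
by rewrite (pi_iso I).
Qed.

(** Arcs are read off the representative of a class, so the exchange is first transported to it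
    along an isomorphism. *)
Lemma slide_arc g g' e p q : slidable g e p q ->
  cgval g' = swap_att g p q ->
  @arc_rel (Gamma n) (\pi_(iso_class n) g) (\pi_(iso_class n) g').
Proof.
move=> sl Eg'.
have [s [t I]] := iso_repr g.
set r := repr _ in I *.
have /hisoP/hiso_symW/hisoP[s' [t' I']] : exists s t, hisom r g s t by exists s, t.
have sl' := hisom_slidable I' sl.
have Isw := hisom_swap p q I'.
have /and3P[mr cr hr] := cgraph_wf r.
suff [f [i [lt W]]] : exists (f : 'I_(6 * n)) (i : bool), f < mate r f /\
    hiso (swap_att r (t' p) (t' q)) (whitehead r f i).
  apply: (@arc_cwhitehead _ f i) => //.
  by rewrite Eg'; apply: hiso_trans W; apply/hisoP; exists s', t'.
(* An edge is encoded by its smaller half-edge; if [t' e] is the larger one, the exchange is viewed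
   from the other end. *)
have := mate_neq (t' e) mr; rewrite neq_ltn => /orP[] lt.
  have sl2 := slidableC mr sl'.
  have [i W] := slide_whitehead mr cr sl2.
  by exists (mate r (t' e)), i; rewrite mateK // swap_attC.
by have [i W] := slide_whitehead mr cr sl'; exists (t' e), i.
Qed.

Lemma arc_rel_sym : symmetric (@arc_rel (Gamma n)).
Proof.
suff W x y : @arc_rel (Gamma n) x y -> @arc_rel (Gamma n) y x.
  by move=> x y; apply/idP/idP; apply: W.
case/existsP=> -[z [e i]] /=; rewrite /gamma_src /gamma_tgt /=.
case/andP=> /eqP zx /eqP <-; rewrite -{}zx {x y}.
have /and3P[mz cz hz] := cgraph_wf (repr z).
have [E|ne] := eqVneq (att (repr z) (val e)) (att (repr z) (mate (repr z) (val e))).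
  have -> : cwhitehead e i = repr z.
    by apply: val_inj; rewrite /= /whitehead E eqxx.
  rewrite reprK; apply/existsP.
  exists (Tagged (fun x => edge_move x) ((e, i) : edge_move z)).
  rewrite /= /gamma_src /gamma_tgt /= eqxx /=; apply/eqP.
  rewrite -[RHS]reprK; congr (\pi _).
  by apply: val_inj; rewrite /= /whitehead E eqxx.
have [p [q [sl W]]] := whitehead_slide i cz ne.
rewrite -[X in arc_rel _ X]reprK.
apply: (@slide_arc _ _ (val e) q p).
  by rewrite cgval_cwhitehead W; exact: slidable_swap.
by rewrite cgval_cwhitehead W swap_attC swap_attK.
Qed.

(** Reachability between classes, stated on graphs so that exchanges can be composed on actual
    graphs instead of representatives. *)
Definition linked g g' : bool :=
  connect (@arc_rel (Gamma n)) (\pi_(iso_class n) g) (\pi_(iso_class n) g').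

Lemma linked_refl g : linked g g.
Proof. exact: connect0. Qed.

Lemma linked_trans g1 g2 g3 : linked g1 g2 -> linked g2 g3 -> linked g1 g3.
Proof. exact: connect_trans. Qed.

Lemma linked_sym g g' : linked g g' -> linked g' g.
Proof. by rewrite /linked (sym_connect_sym arc_rel_sym). Qed.

Lemma linked_iso g g' : hiso g g' -> linked g g'.
Proof. by move=> I; rewrite /linked (pi_iso I) connect0. Qed.

Lemma linked_slide g e p q : slidable g e p q ->
  exists2 g' : cgraph n, cgval g' = swap_att g p q & linked g g'.
Proof.
move=> sl; exists (CGraph (slide_wf (cgraph_wf g) sl)) => //.
by rewrite /linked; apply: connect1; apply: (@slide_arc _ _ e p q sl).
Qed.

End Linked.

(** * Paths *)

(** A simple path with [l] edges: [e i] is the half at [x i] of the edge to [x i.+1]. Values of [x]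
    beyond [l], and of [e] from [l] on, are arbitrary. *)
Definition hpath (m k : nat) (g : hgraph m k) (l : nat) (x : nat -> 'I_m)
    (e : nat -> 'I_k) : Prop :=
  (forall i, i < l -> att g (e i) = x i /\ att g (mate g (e i)) = x i.+1) /\
  (forall i j, i <= l -> j <= l -> x i = x j -> i = j).

Lemma connect_exit (T : finType) (r : rel T) (A : pred T) a b :
  connect r a b -> A a -> ~~ A b -> exists u v, [/\ A u, ~~ A v & r u v].
Proof.
case/connectP=> w + ->; elim: w a => [|y w IH] a /=; first by move=> _ ->.
case/andP=> ray pw Aa Ab; have [Ay|nAy] := boolP (A y); first exact: IH pw Ay Ab.
by exists a, y.
Qed.

Section Paths.
Variables m k : nat.
Implicit Types (g : hgraph m k) (x : nat -> 'I_m) (e : nat -> 'I_k).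

(** The [l.+1] vertices of the path are not all of the [m] vertices, so by connectedness some edge
    leaves the path. *)
Lemma hpath_leave g l x e : wf_hgraph g -> hpath g l x e -> l.+1 < m ->
  exists i f, [/\ i <= l, att g f = x i &
    forall j, j <= l -> att g (mate g f) != x j].
Proof.
move=> /and3P[mg _ hg] [_ xi] lm.
pose A v := [exists j : 'I_l.+1, v == x j].
have [b nAb] : exists b, ~~ A b.
  apply/existsP; rewrite -negb_forall; apply: contraL lm => /forallP H.
  rewrite -leqNgt -[X in X <= _]card_ord -[X in _ <= X]card_ord.
  apply: leq_trans (leq_imset_card (fun j : 'I_l.+1 => x j) predT).
  apply: subset_leq_card; apply/subsetP => v _.
  by have /existsP[j /eqP ->] := H v; apply: imset_f.
have A0 : A (x 0) by apply/existsP; exists ord0.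
have [u [v [/existsP[i /eqP Eu] nAv]]] :=
  connect_exit (forallP (forallP hg (x 0)) b) A0 nAb.
case/existsP=> f /andP[/eqP fu /eqP fv].
exists (i : nat), f; split; [by rewrite -ltnS | by rewrite fu Eu |].
move=> j jl; apply: contraNneq nAv => E; apply/existsP.
by exists (Ordinal (jl : j < l.+1)); rewrite -fv E.
Qed.

(** An edge traversed in both directions would give both [j = i.+1] and [i = j.+1]. *)
Lemma hpath_mate_neq g l x e i j : hpath g l x e -> i < l -> j < l ->
  mate_ok g -> mate g (e i) != e j.
Proof.
move=> [E X] il jl mg; apply/eqP => Eij.
have [Ei Mi] := E i il; have [Ej Mj] := E j jl.
have ji : j = i.+1 by apply: X; [lia|lia|rewrite -Ej -Eij Mi].
have ij : i = j.+1 by apply: X; [lia|lia|rewrite -Mj -Eij mateK // Ei].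
lia.
Qed.

Lemma hpath_inj_e g l x e i j : hpath g l x e -> i < l -> j < l ->
  e i = e j -> i = j.
Proof.
by move=> [E X] il jl Eij; apply: X; try lia; rewrite -(E i il).1 Eij (E j jl).1.
Qed.

(* The move on [f] inserts the far end of [f], a vertex outside the path,
   between [x i] and [x i.+1]. *)
Lemma hpath_insert g l x e i f a : wf_hgraph g -> hpath g l x e -> i < l ->
  att g f = x i -> (forall j, j <= l -> att g (mate g f) != x j) ->
  att g a = att g (mate g f) -> a != mate g f ->
  slidable g f (e i) a /\
  hpath (swap_att g (e i) a) l.+1
    (fun j => if j <= i then x j else if j == i.+1 then att g (mate g f) else x j.-1)
    (fun j => if j < i then e j else if j == i then f else e j.-1).
Proof.
move=> /and3P[mg cg hg] P il fx ny ay anf; have [E X] := P.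
have [Ei Mi] := E i il.
have eif : e i != f by apply: contraTneq (ny i.+1 il) => <-; rewrite Mi eqxx.
have sl : slidable g f (e i) a.
  by split; rewrite ?fx ?Ei // eq_sym; apply: ny; lia.
split=> //.
(* Only [e i] and [a] change ends, and [a] is carried by a vertex outside the path. *)
have att_in h j : j <= l -> att g h = x j -> h != e i ->
    att (swap_att g (e i) a) h = x j.
  move=> jl hj he; rewrite att_swapD //.
  by apply: contraTneq (ny j jl) => ha; rewrite -ay -ha hj eqxx.
have old j : j < l -> att (swap_att g (e i) a) (mate g (e j)) = x j.+1.
  by move=> jl; apply: att_in => //; [exact: (E j jl).2 | exact: (hpath_mate_neq P)].
have Nei : att (swap_att g (e i) a) (e i) = att g (mate g f).
  by rewrite ffunE tpermL ay.
have Nmf : att (swap_att g (e i) a) (mate g f) = att g (mate g f).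
  rewrite att_swapD 1?eq_sym //.
  by apply: contraTneq (ny i (ltnW il)) => <-; rewrite Ei eqxx.
have Mm : mate (swap_att g (e i) a) = mate g by [].
split=> [j jl|j j' jl j'l]; last first.
  have nx c : c <= l -> att g (mate g f) <> x c by move=> /ny/eqP.
  case: (leqP j i) => ji; [|case: (eqVneq j i.+1) => ji1];
    (case: (leqP j' i) => ji'; [|case: (eqVneq j' i.+1) => ji1']) => EE;
    first [lia | by case: (nx _ _ EE); lia | by case: (nx _ _ (esym EE)); lia
          | have := X _ _ _ _ EE; lia].
rewrite Mm; move: (swap_att _ _ _) att_in old Nei Nmf {Mm} => g1 att_in old Nei Nmf.
case: (ltngtP j i) => [ji|ij|->]; last 1 first.
- rewrite eqxx; split=> //.
  by apply: att_in => //; [lia | rewrite eq_sym].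
- split; last by apply: old; lia.
  apply: att_in; [lia | apply: (E j _).1; lia |].
  by apply: contraTneq ji => /(hpath_inj_e P) H; rewrite -leqNgt; lia.
have -> : (j.+1 == i.+1) = false by lia.
split; last by rewrite old; [congr x; lia | lia].
case: eqP => [->|jne] //=.
apply: att_in; [lia | apply: (E _ _).1; lia |].
by apply: contraTneq ij => /(hpath_inj_e P) H; rewrite -leqNgt; lia.
Qed.

Lemma hpath_rcons g l x e f : hpath g l x e -> att g f = x l ->
  (forall j, j <= l -> att g (mate g f) != x j) ->
  hpath g l.+1 (fun j => if j <= l then x j else att g (mate g f))
    (fun j => if j < l then e j else f).
Proof.
move=> [E X] fx ny; split=> [j jl|j j' jl j'l].
  have -> : j <= l by lia.
  by case: ltnP => jl'; [exact: E | have -> : j = l by lia].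
by do 2![case: leqP => ?] => EE; try (by apply: X);
  try (by have := ny j; have := ny j'; rewrite ?EE -?EE ?eqxx; lia); lia.
Qed.

End Paths.

Lemma hpath_extend n (g : cgraph n) l x e : hpath g l x e -> l.+1 < 2 * n ->
  exists2 g' : cgraph n, linked g g' & exists x' e', hpath g' l.+1 x' e'.
Proof.
move=> P ll; have wg := cgraph_wf g; have /and3P[mg cg _] := wg.
have [i [f [il fx ny]]] := hpath_leave wg P ll.
(* An edge leaving from the last vertex is appended without any move; elsewhere the far end is
   inserted. *)
move: il; rewrite leq_eqVlt => /orP[/eqP Ei|il].
  exists g; first exact: linked_refl.
  by eexists; eexists; apply: hpath_rcons P _ ny; rewrite -Ei.
have [a /andP[/eqP ay anf]] :
    exists a, (att g a == att g (mate g f)) && (a != mate g f).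
  have := size_others (mate g f) cg.
  case E: (others _ _) => [|a w] // _; exists a.
  by rewrite -mem_others E mem_head.
have [sl P'] := hpath_insert wg P il fx ny ay anf.
have [g' Eg' L] := linked_slide sl.
by exists g' => //; eexists; eexists; rewrite Eg'; exact: P'.
Qed.

(** A path with [(2 * n).-1] edges is Hamiltonian; it grows from a single vertex, one vertex at a
    time. *)
Lemma hpath_spanning n (g : cgraph n) : 0 < n ->
  exists2 g' : cgraph n, linked g g' & exists x e, hpath g' (2 * n).-1 x e.
Proof.
move=> n0.
have: (2 * n).-1 < 2 * n by lia.
elim: (_.-1) => [|l IH] ll.
  exists g; first exact: linked_refl.
  have n20 : 0 < 2 * n by lia.
  have n60 : 0 < 6 * n by lia.
  exists (fun _ => Ordinal n20), (fun _ => Ordinal n60); split=> //.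
  by move=> [|i] [|j].
have [g1 L1 [x [e P]]] := IH (ltnW ll).
have [g2 L2 H] := hpath_extend P ll.
by exists g2 => //; apply: linked_trans L1 L2.
Qed.

(** * Transpositions of half-edges off a fixed path *)

Definition offpath (m k : nat) (g : hgraph m k) (l : nat) (e : nat -> 'I_k)
    (h : 'I_k) : Prop :=
  forall i, i < l -> h != e i /\ h != mate g (e i).

Lemma hpath_swap_off m k (g : hgraph m k) l x e p q : hpath g l x e ->
  offpath g l e p -> offpath g l e q -> hpath (swap_att g p q) l x e.
Proof.
move=> [E X] op oq; split=> // i il.
have [p1 p2] := op i il; have [q1 q2] := oq i il; have [E1 E2] := E i il.
by rewrite !att_swapD 1?eq_sym.
Qed.

Lemma cubic_third m k (g : hgraph m k) v a b : cubic g ->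
  exists c, [/\ att g c = v, c != a & c != b].
Proof.
move=> /forallP/(_ v)/eqP c3.
have /subsetPn[c] : ~~ ([set h | att g h == v] \subset [set a; b]).
  by apply: contraTN isT => /subset_leq_card; rewrite c3 cards2; case: eqP.
by rewrite !inE negb_or => /eqP ? /andP[? ?]; exists c.
Qed.

Lemma linked_swap1 n (g : cgraph n) l x e i p q : hpath g l x e ->
  i < l -> offpath g l e p -> offpath g l e q ->
  att g p = x i -> att g q = x i.+1 ->
  exists2 g' : cgraph n, cgval g' = swap_att g p q & linked g g'.
Proof.
move=> [E X] il op oq pi qi; apply: (@linked_slide _ _ (e i)).
have [E1 E2] := E i il; split; rewrite ?E1 ?E2 //.
- by apply/eqP => /X; lia.
- exact: (op i il).1.
- exact: (oq i il).2.
Qed.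

Lemma linked_swap n (g : cgraph n) l x e d i p q : hpath g l x e ->
  i + d <= l -> offpath g l e p -> offpath g l e q ->
  att g p = x i -> att g q = x (i + d) ->
  exists2 g' : cgraph n, cgval g' = swap_att g p q & linked g g'.
Proof.
elim: d i g p q => [|[|d] IH] i g p q P il op oq pi qi.
- exists g; rewrite ?linked_refl // swap_att_id //.
  by rewrite pi qi addn0.
- by apply: linked_swap1 P _ op oq pi _; rewrite ?qi ?addn1 // -addn1.
have [E X] := P; have /and3P[mg cg _] := cgraph_wf g.
(* Two of the three half-edges at the inner vertex [x i.+1] belong to the path; the third, [k], is
   off the path. *)
have [k [ki kn kn']] := cubic_third (x i.+1) (mate g (e i)) (e i.+1) cg.
have ok : offpath g l e k.
  move=> j jl; have [E1 E2] := E j jl; split; apply/eqP => kj.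
    have ji : j = i.+1 by apply: X; [lia|lia|rewrite -E1 -kj ki].
    by rewrite kj ji eqxx in kn'.
  have ji : j.+1 = i.+1 by apply: X; [lia|lia|rewrite -E2 -kj ki].
  by case: ji => ji; rewrite kj ji eqxx in kn.
have npk : p != k by apply/eqP => pk; move: ki; rewrite -pk pi => /X; lia.
have nqk : q != k by apply/eqP => qk; move: ki; rewrite -qk qi => /X; lia.
have npq : p != q by apply/eqP => pq; move: qi; rewrite -pq pi => /X; lia.
have il' : i < l by lia.
have [g1 E1 L1] := linked_swap1 P il' op ok pi ki.
have P1 : hpath g1 l x e by rewrite E1; apply: hpath_swap_off.
have off1 h : offpath g l e h -> offpath g1 l e h by rewrite E1.
have p1 : att g1 p = x i.+1 by rewrite E1 ffunE tpermL ki.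
have q1 : att g1 q = x (i.+1 + d.+1).
  by rewrite E1 att_swapD ?(eq_sym q) // 1?eq_sym // addSnnS.
have k1 : att g1 k = x i by rewrite E1 ffunE tpermR pi.
have il1 : i.+1 + d.+1 <= l by lia.
have [g2 E2 L2] := IH i.+1 g1 p q P1 il1 (off1 _ op) (off1 _ oq) p1 q1.
have P2 : hpath g2 l x e by rewrite E2; apply: hpath_swap_off => //; apply: off1.
have off2 h : offpath g l e h -> offpath g2 l e h by rewrite E2 E1.
have k2 : att g2 k = x i by rewrite E2 att_swapD // eq_sym.
have q2 : att g2 q = x i.+1 by rewrite E2 ffunE tpermR.
have [g3 E3 L3] := linked_swap1 P2 il' (off2 _ ok) (off2 _ oq) k2 q2.
exists g3; last exact: linked_trans (linked_trans L1 L2) L3.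
(* The product of the three transpositions is the transposition of [p] and [q]. *)
rewrite E3 E2 E1; apply: hgraph_eq => // h; rewrite !ffunE.
congr (att g _); rewrite !permE /=.
have N (u v : 'I_(6 * n)) : u != v -> ((u == v) = false) * ((v == u) = false).
  by move=> /negPf uv; rewrite [v == u]eq_sym uv.
have NE := (N _ _ npk, N _ _ nqk, N _ _ npq, eqxx).
have [E4 | hk] := eqVneq h k; first by rewrite ?E4 !NE.
have [E4 | hq] := eqVneq h q; first by rewrite ?E4 !NE.
have [E4 | hp] := eqVneq h p; first by rewrite ?E4 !NE.
by rewrite (negPf hq) (negPf hp) (negPf hk).
Qed.

(** * Comparing two graphs with Hamiltonian paths *)

Section SpanningPaths.
Variables m k : nat.
Implicit Types (g : hgraph m k) (x : nat -> 'I_m) (e : nat -> 'I_k).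

Lemma spanning_hpath_onto g x e v : hpath g m.-1 x e ->
  exists2 i, i <= m.-1 & v = x i.
Proof.
move=> [_ X]; have inj : injective (fun i : 'I_m => x i).
  by move=> i j /X ij; apply/val_inj/ij; have := ltn_ord i; have := ltn_ord j; lia.
have /codomP[i ->] := injF_onto inj v.
by exists (i : nat) => //; have := ltn_ord i; lia.
Qed.

Lemma perm_of_seqs (T : finType) (s s' : seq T) : uniq s -> uniq s' ->
  size s = size s' -> (forall z, z \in s) -> exists t : {perm T}, map t s = s'.
Proof.
case: s s' => [|z0 s0] s'; first by case: s' => //; exists 1%g.
set s := z0 :: s0 => us us' E H.
have inj : injective (fun z => nth z0 s' (index z s)).
  move=> a b /eqP; rewrite nth_uniq -?E ?index_mem // => /eqP ab.
  by rewrite -(nth_index z0 (H a)) ab nth_index.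
exists (perm inj); apply: (@eq_from_nth _ z0); rewrite size_map // => i si.
by rewrite (nth_map z0) // permE index_uniq.
Qed.

(** The added list takes the smaller half of every edge not met by [s]. Matching two such
    enumerations entry by entry gives a bijection of half-edges compatible with the pairings. *)
Lemma half_edges_complete g (s : seq 'I_k) : mate_ok g ->
  uniq (s ++ map (mate g) s) -> exists s2,
    uniq ((s ++ s2) ++ map (mate g) (s ++ s2)) /\
    forall h, h \in (s ++ s2) ++ map (mate g) (s ++ s2).
Proof.
move=> mg; rewrite cat_uniq => /and3P[us /hasPn ns um].
have mI := can_inj (mateK mg).
have mem_mate h (w : seq 'I_k) : (h \in map (mate g) w) = (mate g h \in w).
  by rewrite -[h in LHS](mateK mg) mem_map.
exists [seq h <- enum 'I_k | [&& h \notin s, mate g h \notin s & h < mate g h]].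
set s2 := filter _ _.
have s2E h : (h \in s2) = [&& h \notin s, mate g h \notin s & h < mate g h].
  by rewrite mem_filter mem_enum andbT.
have u2 : uniq (s ++ s2).
  rewrite cat_uniq us filter_uniq ?enum_uniq // andbT.
  by apply/hasPn => h; rewrite s2E => /and3P[].
split=> [|h].
  rewrite cat_uniq u2 map_inj_uniq // u2 andbT; apply/hasPn => h.
  rewrite mem_mate !mem_cat !s2E negb_or mateK // => /orP[hs|/and3P[h1 h2 h3]].
    have := ns h; rewrite mem_mate hs => /(_ isT) ->.
    by [].
  by rewrite h2 h1 /= -leqNgt ltnW.
rewrite mem_cat mem_mate !mem_cat !s2E mateK //.
case: (h \in s) => //=; case: (mate g h \in s); rewrite ?orbT //=.
by have := mate_neq h mg; rewrite neq_ltn orbC.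
Qed.

Lemma hpath_uniq g l x e : mate_ok g -> hpath g l x e ->
  uniq (mkseq e l ++ map (mate g) (mkseq e l)).
Proof.
move=> mg P; have ue : uniq (mkseq e l).
  by apply/mkseq_uniqP => i j il jl; apply: (hpath_inj_e P).
rewrite cat_uniq ue map_inj_uniq ?ue ?andbT; last exact: can_inj (mateK mg).
apply/hasPn => h /mapP[h' /mapP[i]]; rewrite mem_iota => il -> ->.
by apply/mapP => -[j]; rewrite mem_iota => jl /eqP; apply/negP/(hpath_mate_neq P).
Qed.

(** Relabelling along the two paths makes the path and the pairing agree with those of [g']; only
    the vertices carrying off-path half-edges may still differ. *)
Lemma spanning_hpath_iso g g' x e x' e' : mate_ok g -> mate_ok g' ->
  hpath g m.-1 x e -> hpath g' m.-1 x' e' -> 0 < m ->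
  exists g1, [/\ hiso g g1, mate g1 = mate g' & hpath g1 m.-1 x' e'].
Proof.
move=> mg mg' P P' m0.
have [s Es] : exists s : {perm 'I_m}, map s (mkseq x m) = mkseq x' m.
  have U y f (G : hgraph m k) : hpath G m.-1 y f -> uniq (mkseq y m).
    by case=> _ Y; apply/mkseq_uniqP => i j; rewrite !inE => im jm; apply: Y; lia.
  apply: perm_of_seqs; rewrite ?size_mkseq ?(U _ _ _ P) ?(U _ _ _ P') //.
  move=> z; have [i im ->] := spanning_hpath_onto z P.
  by apply/mapP; exists i => //; rewrite mem_iota; lia.
have sx i : i < m -> s (x i) = x' i.
  move=> im; rewrite -(nth_mkseq (x' 0) x' im) -Es (nth_map (x 0)) ?size_mkseq //.
  by rewrite nth_mkseq.
have [w [uw aw]] := half_edges_complete mg (hpath_uniq mg P).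
have [w' [uw' aw']] := half_edges_complete mg' (hpath_uniq mg' P').
have sz (v : seq 'I_k) : uniq v -> (forall h, h \in v) -> size v = k.
  move=> uv av; rewrite -[RHS](card_ord k) -(card_uniqP uv).
  by apply: eq_card => h; rewrite av.
have szE : size (mkseq e m.-1 ++ w) = size (mkseq e' m.-1 ++ w').
  apply: double_inj; rewrite -!addnn.
  have := sz _ uw' aw'; have := sz _ uw aw.
  by rewrite !(size_cat (_ ++ _)) !size_map => -> ->.
(* Each enumeration is a list followed by the list of its mates, so [t] commutes with [mate]; both
   begin with the path, so [t] maps [e i] to [e' i]. *)
have [t Et] := perm_of_seqs uw uw' (etrans (sz _ uw aw) (esym (sz _ uw' aw'))) aw.
move: Et; rewrite map_cat => /eqP; rewrite eqseq_cat ?size_map //.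
move=> /andP[/eqP E1 /eqP E2].
have tm h : t (mate g h) = mate g' (t h).
  have tmE h0 : h0 \in mkseq e m.-1 ++ w -> t (mate g h0) = mate g' (t h0).
    move=> hin; have /eqP := E2; rewrite -E1 -!map_comp => /eqP/eq_in_map/(_ _ hin).
    by [].
  have := aw h; rewrite mem_cat => /orP[/tmE //|/mapP[h0 /tmE h0E ->]].
  by rewrite h0E !mateK.
have te i : i < m.-1 -> t (e i) = e' i.
  move=> im; move: E1 => /eqP; rewrite map_cat eqseq_cat ?size_map ?size_iota //.
  move=> /andP[/eqP E1 _].
  rewrite -(nth_mkseq (e' i) e' im) -E1 (nth_map (e i)) ?size_mkseq //.
  by rewrite nth_mkseq.
exists (HGraph [ffun h => s (att g (t^-1%g h))] (mate g')); split=> //.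
  by apply/hisoP; exists s, t; split=> h /=; rewrite ?ffunE ?permK // tm.
have [Eg X] := P; have [Eg' X'] := P'; split=> //= i im; have [A B] := Eg i im.
by rewrite !ffunE -te // -tm !permK A B !sx //; lia.
Qed.

End SpanningPaths.

(** Induction on the number of half-edges carried by different vertices in [g] and [g']: one
    transposition off the path puts a misplaced half-edge in its place. *)
Lemma linked_spanning n (g g' : cgraph n) x e : mate g = mate g' ->
  hpath g (2 * n).-1 x e -> hpath g' (2 * n).-1 x e -> linked g g'.
Proof.
have [c] := ubnP #|[set h | att g h != att g' h]|.
elim: c g => // c IH g lc Em P P'.
have /and3P[mg cg _] := cgraph_wf g; have /and3P[mg' cg' _] := cgraph_wf g'.
have [->|[h hn]] : g = g' \/ exists h, att g h != att g' h.
  case: (pickP (fun h => att g h != att g' h)) => [h ?|H]; [by right; exists h|left].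
  by apply/val_inj/hgraph_eq => // h; apply/eqP; rewrite -[_ == _]negbK H.
  exact: linked_refl.
(* The vertex where [h] belongs carries three half-edges in both graphs, and [h] only in [g']; hence
   in [g] it carries some [h'] that does not belong there. *)
have [h' [h1 h2]] : exists h', att g h' = att g' h /\ att g' h' != att g' h.
  have : ~~ ([set z | att g z == att g' h] \subset [set z | att g' z == att g' h]).
    apply/negP => sub; have := subset_cardP _ sub.
    rewrite (eqP (forallP cg _)) (eqP (forallP cg' _)) => /(_ erefl h).
    by rewrite !inE eqxx (negPf hn).
  by case/subsetPn=> z; rewrite !inE => /eqP ? ?; exists z.
(* On the half-edges of the common path the two attachments agree, so misplaced half-edges are off
   the path. *)
have off z : att g z != att g' z -> offpath g (2 * n).-1 e z.
  move=> zn i il; have [A B] := P.1 i il; have [A' B'] := P'.1 i il.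
  by split; apply: contraNneq zn => ->; rewrite ?A ?A' // B Em B'.
have hn' : att g h' != att g' h' by rewrite h1 eq_sym.
have [i il hi] := spanning_hpath_onto (att g h) P.
have [j jl hj] := spanning_hpath_onto (att g h') P.
have [g1 E1 L1] : exists2 g1 : cgraph n, cgval g1 = swap_att g h h' & linked g g1.
  have [ij|ji] := leqP i j.
    by apply: (linked_swap P (i := i) (d := j - i)); rewrite ?subnKC //; apply: off.
  rewrite swap_attC.
  by apply: (linked_swap P (i := j) (d := i - j));
    rewrite ?subnKC ?(ltnW ji) //; apply: off.
apply: linked_trans L1 _; apply: IH.
(* The exchange corrects [h], and [h'] was misplaced before, so the set of misplaced half-edges
   shrinks strictly. *)
- rewrite ltnS in lc; apply: leq_trans lc; apply: proper_card; apply/properP; split.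
    apply/subsetP => z; rewrite !inE E1 ffunE; case: tpermP => [->|->|//].
      by rewrite h1 eqxx.
    by [].
  by exists h; rewrite !inE // E1 ffunE tpermL h1 eqxx.
- by rewrite E1.
- by rewrite E1; apply: hpath_swap_off => //; apply: off.
- by [].
Qed.

Lemma linked_all n (g g' : cgraph n) : 0 < n -> linked g g'.
Proof.
move=> n0.
have [g1 L1 [x [e P]]] := hpath_spanning g n0.
have [g1' L1' [x' [e' P']]] := hpath_spanning g' n0.
have /and3P[mg _ _] := cgraph_wf g1; have /and3P[mg' _ _] := cgraph_wf g1'.
have n20 : 0 < 2 * n by lia.
have [h [I Em Ph]] := spanning_hpath_iso mg mg' P P' n20.
pose g2 := CGraph (hiso_wf I (cgraph_wf g1)).
apply: linked_trans L1 _; apply: linked_trans (linked_iso (g' := g2) I) _.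
apply: linked_trans (linked_sym L1').
exact: (@linked_spanning _ g2 g1' x' e').
Qed.

Lemma Gamma_connected n : 0 < n -> forall x y : node (Gamma n),
  connect (@arc_rel (Gamma n)) x y.
Proof.
move=> n0 x y; rewrite -[x]reprK -[y]reprK.
exact: linked_all.
Qed.

(** * The necklace *)

Lemma card_fiber_leq (T U : finType) (f : T -> U) (D : {set T}) (B : {set U}) c :
  (forall x, x \in D -> f x \in B) ->
  (forall u, u \in B -> #|[set x in D | f x == u]| <= c) -> #|D| <= #|B| * c.
Proof.
move=> DB Bc; rewrite -sum1_card (partition_big f (mem B)) //=.
rewrite -sum_nat_const; apply: leq_sum => u /Bc; apply: leq_trans.
by rewrite sum1dep_card; apply: eq_leq; apply: eq_card => x; rewrite !inE.
Qed.

(** The isomorphism invariant that tells the necklace, where it holds at every vertex, from its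
    neighbours; loops do not count as double edges. *)
Definition doubled (m k : nat) (g : hgraph m k) (v : 'I_m) : bool :=
  [exists f1, exists f2, [&& f1 != f2, att g f1 == v, att g f2 == v,
    att g (mate g f1) == att g (mate g f2) & att g (mate g f1) != v]].

Section Doubled.
Variables m k : nat.
Implicit Types g : hgraph m k.

Lemma hisom_doubled g g' s t v : hisom g g' s t ->
  doubled g' (s v) = doubled g v.
Proof.
move=> [Ha Hm]; apply/existsP/existsP.
  case=> f1 /existsP[f2]; rewrite -[f1](permKV t) -[f2](permKV t) !Hm !Ha.
  rewrite !(inj_eq perm_inj) => H.
  exists (t^-1%g f1); apply/existsP; exists (t^-1%g f2).
  by rewrite (inj_eq perm_inj).
case=> f1 /existsP[f2 H]; exists (t f1); apply/existsP; exists (t f2).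
by rewrite !Hm !Ha !(inj_eq perm_inj).
Qed.

(** The exchange affects only the edges of [p] and [q], whose ends are the four excluded
    vertices. *)
Lemma doubled_swap g p q v : mate_ok g -> doubled g v ->
  v \notin [set att g p; att g q; att g (mate g p); att g (mate g q)] ->
  doubled (swap_att g p q) v.
Proof.
move=> mg /existsP[f1 /existsP[f2 /and5P[n12 /eqP f1v /eqP f2v E N]]].
rewrite !inE !negb_or => /andP[/andP[/andP[vp vq] vp'] vq'].
have D h : att g h = v -> att (swap_att g p q) h = v /\
    att (swap_att g p q) (mate g h) = att g (mate g h).
  move=> hv; split; first by rewrite att_swap hv.
  rewrite att_swapD //.
    by apply: contraNneq vp' => <-; rewrite mateK // hv.
  by apply: contraNneq vq' => <-; rewrite mateK // hv.
have [a1 b1] := D _ f1v; have [a2 b2] := D _ f2v.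
apply/existsP; exists f1; apply/existsP; exists f2.
have Mm : mate (swap_att g p q) = mate g by [].
by rewrite Mm a1 a2 b1 b2 n12 E N eqxx.
Qed.

(** At most four vertices can lose their double edges, and each carries three half-edges. *)
Lemma card_undoubled_swap g p q : mate_ok g -> cubic (swap_att g p q) ->
  (forall v, doubled g v) ->
  #|[set h | ~~ doubled (swap_att g p q) (att (swap_att g p q) h)]| <= 12.
Proof.
move=> mg cg dg; set g' := swap_att g p q.
set B := [set att g p; att g q; att g (mate g p); att g (mate g q)].
have B4 : #|B| <= 4.
  have U1 (A : {set 'I_m}) v : #|A :|: [set v]| <= #|A| + 1.
    by rewrite -[X in _ + X](cards1 v); apply: leq_card_setU.
  apply: leq_trans (U1 _ _) _; rewrite -[4]/(3 + 1) leq_add2r.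
  apply: leq_trans (U1 _ _) _; rewrite -[3]/(2 + 1) leq_add2r.
  by apply: leq_trans (U1 _ _) _; rewrite cards1.
apply: leq_trans (card_fiber_leq (f := att g') (B := B) (c := 3) _ _) _.
- move=> h; rewrite inE; apply: contraR => hB; exact: doubled_swap.
- move=> v _; rewrite -(eqP (forallP cg v)); apply: subset_leq_card.
  by apply/subsetP => h; rewrite !inE => /andP[].
- by rewrite -[12]/(4 * 3) leq_mul2r.
Qed.

Lemma hiso_swap_mate g p : mate_ok g -> hiso g (swap_att g p (mate g p)).
Proof.
move=> mg; apply/hisoP; exists 1%g, (tperm p (mate g p)); split=> h /=.
  by rewrite ffunE tpermK perm1.
case: (tpermP p (mate g p)) => [->|->|/eqP hp /eqP hm];
  rewrite ?mateK ?tpermR ?tpermL //.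
by rewrite tpermD // eq_sym ?mate_eq // mateK.
Qed.

End Doubled.

Section Necklace.
Variable m : nat.
Local Open Scope ring_scope.

(* The [j]-th bead is a double edge between the vertices [(j, false)] and
   [(j, true)]; the half-edge [(v, None)] is the one leaving the bead at [v]. *)
Definition bead_vertex : finType := ('I_m.+1 * bool)%type.
Definition bead_half : finType := (bead_vertex * option bool)%type.

(** A generator of the cyclic group of beads; it is [0] when there is only one bead. *)
Definition bead_step : 'I_m.+1 := inZp 1.

Definition bead_mate (z : bead_half) : bead_half :=
  let: ((j, b), c) := z in
  if c is Some _ then ((j, ~~ b), c)
  else ((if b then j + bead_step else j - bead_step, ~~ b), c).

Lemma bead_mateK : involutive bead_mate.
Proof. by case=> [[j []] [c|]] //=; rewrite ?addrK ?subrK. Qed.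

Lemma bead_mate_neq z : bead_mate z != z.
Proof. by case: z => [[j []] [c|]] //=; rewrite !xpair_eqE ?andbF. Qed.

Lemma bead_step_mulrn (j : 'I_m.+1) : bead_step *+ j = j.
Proof. by apply: val_inj; rewrite Zp_mulrn /= modnMml mul1n modn_small. Qed.

(** The bijections [phi] and [psi] name vertices and half-edges by beads, so that computations take
    place on beads instead of ordinals. *)
Definition necklace (g : hgraph (2 * m.+1) (6 * m.+1)) phi psi : Prop :=
  [/\ bijective phi, bijective psi,
      forall z : bead_half, att g (psi z) = phi z.1 :> 'I_(2 * m.+1) &
      forall z, mate g (psi z) = psi (bead_mate z) :> 'I_(6 * m.+1)].

Lemma ordinal_bij (T : finType) k : #|T| = k -> exists f : T -> 'I_k, bijective f.
Proof.
move=> E; exists (fun x => cast_ord E (enum_rank x)).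
by exists (fun i => enum_val (cast_ord (esym E) i)) => x;
  rewrite ?cast_ordK ?enum_rankK ?enum_valK ?cast_ordKV.
Qed.

Lemma necklace_exists : exists g phi psi, necklace g phi psi.
Proof.
have [|phi bphi] := @ordinal_bij bead_vertex (2 * m.+1).
  by rewrite card_prod card_ord card_bool mulnC.
have [|psi bpsi] := @ordinal_bij bead_half (6 * m.+1).
  by rewrite !card_prod card_ord card_option card_bool -mulnA mulnC.
have [psi' psiK _] := bpsi.
exists (HGraph [ffun h => phi (psi' h).1] [ffun h => psi (bead_mate (psi' h))]).
by exists phi, psi; split=> // z; rewrite ffunE psiK.
Qed.

Section Fixed.
Variables (g : hgraph (2 * m.+1) (6 * m.+1)).
Variables (phi : bead_vertex -> 'I_(2 * m.+1)) (psi : bead_half -> 'I_(6 * m.+1)).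
Hypothesis N : necklace g phi psi.

Let phiI : injective phi. Proof. by case: N => /bij_inj. Qed.
Let psiI : injective psi. Proof. by case: N => _ /bij_inj. Qed.
Let attE z : att g (psi z) = phi z.1. Proof. by case: N. Qed.
Let mateE z : mate g (psi z) = psi (bead_mate z). Proof. by case: N. Qed.

Let psi_onto h : exists z, h = psi z.
Proof. by case: N => _ [f _ K] _ _; exists (f h). Qed.

Let phi_onto v : exists u, v = phi u.
Proof. by case: N => [[f _ K]] _ _ _; exists (f v). Qed.

Lemma necklace_mate_ok : mate_ok g.
Proof.
apply/forallP => h; have [z ->] := psi_onto h.
by rewrite !mateE bead_mateK eqxx (inj_eq psiI) bead_mate_neq.
Qed.

Lemma necklace_cubic : cubic g.
Proof.
apply/forallP => v; have [u ->] := phi_onto v.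
have -> : [set h | att g h == phi u] = [set psi (u, c) | c : option bool].
  apply/setP => h; have [[w c] ->] := psi_onto h; rewrite inE attE (inj_eq phiI) /=.
  apply/eqP/imsetP => [->|[c' _ /psiI[-> _]] //]; by exists c.
by rewrite card_imset ?cardT -?cardE ?card_option ?card_bool // => c c' /psiI[].
Qed.

Lemma necklace_connected : hconnected g.
Proof.
have adjS : symmetric (adj g).
  suff W u v : adj g u v -> adj g v u by move=> u v; apply/idP/idP; apply: W.
  case/existsP=> h /andP[hu hv]; apply/existsP; exists (mate g h).
  by rewrite hv mateK ?necklace_mate_ok.
have step z : connect (adj g) (phi z.1) (phi (bead_mate z).1).
  by apply: connect1; apply/existsP; exists (psi z); rewrite mateE !attE !eqxx.
(* Starting at bead [0], each bead is crossed and then left through its outer edge at the end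
   [true]. *)
have base i b : connect (adj g) (phi (0, false)) (phi (bead_step *+ i, b)).
  have both j : connect (adj g) (phi (0, false)) (phi (j, false)) ->
      connect (adj g) (phi (0, false)) (phi (j, b)).
    case: b => // /connect_trans; apply; exact: (step ((j, false), Some true)).
  apply: both; elim: i => [|i IH]; first by rewrite mulr0n connect0.
  apply: connect_trans IH _.
  apply: connect_trans (step ((_, false), Some true)) _ => /=.
  by rewrite mulrSr; exact: (step ((_, true), None)).
apply/forallP => u; apply/forallP => v.
have [[j b] ->] := phi_onto u; have [[j' b'] ->] := phi_onto v.
apply: (@connect_trans _ _ (phi (0, false))).
  by rewrite (sym_connect_sym adjS) -[j]bead_step_mulrn.
by rewrite -[j']bead_step_mulrn.
Qed.

Lemma necklace_wf : wf_hgraph g.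
Proof.
by rewrite /wf_hgraph necklace_mate_ok necklace_cubic necklace_connected.
Qed.

Lemma necklace_doubled v : doubled g v.
Proof.
have [[j b] ->] := phi_onto v; apply/existsP; exists (psi ((j, b), Some true)).
apply/existsP; exists (psi ((j, b), Some false)).
rewrite !mateE !attE (inj_eq psiI) (inj_eq phiI) !xpair_eqE !eqxx /=.
by rewrite (inj_eq phiI) xpair_eqE; case: (b); rewrite andbF.
Qed.

(** The shift by [i] commutes with [bead_mate]; it serves to bring the edge of a move to bead
    [0]. *)
Lemma necklace_rotation i : exists s t, hisom g g s t /\
  forall j b c, t (psi ((j, b), c)) = psi ((j + i, b), c).
Proof.
have [[phi' phiK phi'K] [psi' psiK psi'K] _ _] := N.
pose rv (v : bead_vertex) : bead_vertex := (v.1 + i, v.2).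
pose rh (z : bead_half) : bead_half := (rv z.1, z.2).
have rvI : injective rv.
  move=> [j b] [j' b'] E; have /= -> := addIr i (congr1 fst E).
  by congr pair; exact: (congr1 snd E).
have rhI : injective rh.
  move=> [v c] [v' c'] E; rewrite (rvI v v' (congr1 fst E)).
  by congr pair; exact: (congr1 snd E).
have sI : injective (fun v => phi (rv (phi' v))).
  by move=> v v' /phiI/rvI/(can_inj phi'K).
have tI : injective (fun h => psi (rh (psi' h))).
  by move=> h h' /psiI/rhI/(can_inj psi'K).
exists (perm sI), (perm tI); split=> [|j b c]; last by rewrite permE psiK.
split=> h; have [z ->] := psi_onto h; rewrite !permE psiK.
  by rewrite !attE phiK.
rewrite !mateE psiK; congr psi.
by case: z => [[j []] [c|]] //=; rewrite /rh /rv /=; congr (_, _, _); rewrite addrAC.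
Qed.

(** Once the bead of [e] is rotated to [0], there remain the end [b] and three choices for each of
    [c], [c1] and [c2]: 54 codes. *)
Lemma necklace_slide_code e p q : slidable g e p q ->
  exists b c c1 c2, hiso (swap_att g p q)
    (swap_att g (psi ((0, b), c1)) (psi ((bead_mate ((0, b), c)).1, c2))).
Proof.
have [[[j b] c] ->] := psi_onto e => sl.
have [s [t [I tE]]] := necklace_rotation (- j).
have := hisom_slidable I sl; rewrite tE subrr.
have [[u c1] Ep] := psi_onto (t p); have [[v c2] Eq] := psi_onto (t q).
have Isw := hisom_swap p q I; move: Isw; rewrite Ep Eq => Isw.
case=> _; rewrite mateE !attE => /phiI /= Eu _ /phiI /= Ev _.
by exists b, c, c1, c2; apply/hisoP; exists s, t; move: Isw; rewrite Eu Ev.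
Qed.

Lemma necklace_others u a b c : a != b -> a != c -> b != c ->
  others g (psi (u, c)) =i [:: psi (u, a); psi (u, b)].
Proof.
move=> ab ac bc h; have [[w x] ->] := psi_onto h.
rewrite mem_others !attE !inE !(inj_eq psiI) (inj_eq phiI) !xpair_eqE /=.
by case: (w == u) => //=; move: ab ac bc; case: a b c x => [[]|] [[]|] [[]|] [[]|].
Qed.

(** After the exchange, [tperm p q (u, c)] takes the place of [(u, c)], and [w c] is the vertex at
    its far end. If far ends coincide only at [u] itself, by a loop, then no double edge ends at
    [u]. *)
Lemma necklace_undoubled u p q (w : option bool -> bead_vertex) :
  (forall c, (tperm p q (bead_mate (tperm p q (u, c)))).1 = w c) ->
  (forall c1 c2, c1 != c2 -> w c1 = w c2 -> w c1 = u) ->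
  ~~ doubled (swap_att g (psi p) (psi q)) (phi u).
Proof.
move=> wE W; apply/negP => /existsP[f1 /existsP[f2]].
have [z1 ->] := psi_onto f1; have [z2 ->] := psi_onto f2.
rewrite -[z1](tpermK p q) -[z2](tpermK p q).
move: (tperm p q z1) (tperm p q z2) => [u1 c1] [u2 c2] /and5P[].
have Mm : mate (swap_att g (psi p) (psi q)) = mate g by [].
rewrite !Mm !mateE !ffunE -!(inj_tperm _ _ _ psiI) !attE !tpermK !(inj_eq phiI) /=.
move=> n /eqP E1 /eqP E2 /eqP E; rewrite {u1}E1 {u2}E2 !wE in n E *.
apply/negP; rewrite negbK (W c1 c2) //.
by apply: contraNneq n => ->.
Qed.

Let bead_step_eq j : (0 < m)%N ->
  ((j + bead_step == j) = false) * ((j == j + bead_step) = false) *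
  ((j - bead_step == j) = false) * ((j == j - bead_step) = false).
Proof.
move=> m0; have s0 : (bead_step == 0) = false.
  by apply/eqP => /(congr1 val) /=; rewrite modn_small.
have jD : (j + bead_step == j) = false by rewrite -subr_eq0 addrAC subrr add0r.
have jB : (j - bead_step == j) = false.
  by rewrite -subr_eq0 addrAC subrr add0r oppr_eq0.
by rewrite ![j == _]eq_sym.
Qed.

(** The far ends at [(j, b)] become the two vertices of the adjacent bead and the other vertex of
    its own bead; these are distinct since there are at least two beads. *)
Lemma necklace_slide_outer j b c1 c2 : (0 < m)%N -> c1 != None -> c2 != None ->
  ~~ doubled (swap_att g (psi ((j, b), c1))
       (psi ((bead_mate ((j, b), None)).1, c2))) (phi (j, b)).
Proof.
move=> m0 n1 n2; have jE := bead_step_eq j m0.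
have {n1}[x c1E] : exists x, c1 = Some x by case: (c1) n1 => // x _; exists x.
have {n2}[y c2E] : exists y, c2 = Some y by case: (c2) n2 => // y _; exists y.
pose j' := if b then j + bead_step else j - bead_step.
have j'E : (j' == j) = false by rewrite /j'; case: (b); rewrite jE.
apply: (@necklace_undoubled _ _ _ (fun k => if k == None then (j', ~~ b) else
  if k == Some x then (j', b) else (j, ~~ b))).
  rewrite c1E c2E /j' /= => k; rewrite !permE.
  by case: x {c1E}; case: k => [[]|]; case: b {j' j'E};
    do 3![rewrite /= ?(xpair_eqE, jE, eqxx, andbF)].
move: j' j'E => j' j'E; have j'E' := eq_sym j j'.
by move=> k1 k2 nk E; exfalso; move/eqP: E; apply/negP;
  move: nk; case: x {c1E}; case: k1 => [[]|]; case: k2 => [[]|] // _;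
  case: b; rewrite /= ?(xpair_eqE, j'E', j'E, eqxx, andbF).
Qed.

(** The edge lies in a bead or joins two beads. Inside a bead, the outcome depends on which of the
    exchanged half-edges leave the bead. *)
Lemma necklace_slide e p q : (0 < m)%N -> slidable g e p q ->
  ~~ doubled (swap_att g p q) (att g e) \/ hiso g (swap_att g p q).
Proof.
move=> m0; have [[[j b] c] ->] := psi_onto e.
have [[u c1] ->] := psi_onto p; have [[v c2] ->] := psi_onto q.
case=> ne; move: ne; rewrite mateE !attE !(inj_eq psiI) => ne.
move=> /phiI /= -> n1 /phiI /= -> n2.
have {}n1 : c1 != c by apply: contraNneq n1 => ->.
have {}n2 : c2 != c.
  by apply: contraNneq n2 => ->; case: (c) => [y|].
have jE := bead_step_eq j m0.
have [[y cE]|cN] : (exists y, c = Some y) \/ c = None.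
  by case: (c) => [y|]; [left; exists y | right].
  have [E|NE] := eqVneq c1 c2.
    (* The exchange swaps the two halves of the parallel edge, or is complementary to that exchange
       when both half-edges leave the bead. *)
    right.
    have : hiso g (swap_att g (psi ((j, b), Some (~~ y)))
                     (psi ((j, ~~ b), Some (~~ y)))).
      have := hiso_swap_mate (psi ((j, b), Some (~~ y))) necklace_mate_ok.
      by rewrite mateE.
    have [|c1N] := eqVneq c1 (Some (~~ y)); first by rewrite -E cE => ->.
    have {}c1N : c1 = None by move: n1 c1N; rewrite cE; case: (c1) (y) => [[]|] [].
    rewrite -E c1N cE => /hiso_trans; apply.
    apply: (@hiso_swap_complement _ _ _ (psi ((j, b), c))).
    - exact: necklace_mate_ok.
    - by rewrite mateE !attE.
    - by rewrite (inj_eq psiI) xpair_eqE /= andbF.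
    - by rewrite (inj_eq psiI) xpair_eqE /= andbF.
    - by rewrite cE; apply: necklace_others => //; case: (y).
    - by rewrite mateE cE; apply: necklace_others => //; case: (y).
  left; rewrite cE in n1 n2 *; have [c1N|c1N] := eqVneq c1 None.
    have {n1 n2 NE}c2E : c2 = Some (~~ y).
      by move: n2 NE; rewrite c1N; case: (c2) (y) => [[]|] [].
    (* The parallel edge becomes a loop at [(j, b)], whose only other edge is that of [e]. *)
    apply: (@necklace_undoubled _ _ _
      (fun k => if k == Some y then (j, ~~ b) else (j, b))).
      rewrite c1N c2E => k; rewrite !permE.
      by case: y {cE c2E ne}; case: k => [[]|]; case: b;
        do 3![rewrite /= ?(xpair_eqE, jE, eqxx, andbF)].
    move=> k1 k2; have [->|//] := eqVneq k1 (Some y).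
    by have [E|] := eqVneq k2 (Some y); rewrite ?E ?eqxx.
  have {n1}c1E : c1 = Some (~~ y) by move: n1 c1N; case: (c1) (y) => [[]|] [].
  have {n2 NE}c2E : c2 = None.
    by move: n2 NE; rewrite c1E; case: (c2) (y) => [[]|] [].
  (* The loop now lies at the other end of the bead, and [(j, b)] receives both outer edges; its
     three far ends are distinct. *)
  apply: (@necklace_undoubled _ _ _ (fun k => if k == Some y then (j, ~~ b) else
    if k is Some _ then (if b then j - bead_step else j + bead_step, b)
    else (if b then j + bead_step else j - bead_step, ~~ b))).
    rewrite c1E c2E => k; rewrite !permE.
    by case: y {cE c1E c2E ne c1N}; case: k => [[]|]; case: b;
        do 3![rewrite /= ?(xpair_eqE, jE, eqxx, andbF)].
  by move=> k1 k2 nk E; exfalso; move/eqP: E; apply/negP;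
    move: nk; case: y {cE c1E c2E ne c1N}; case: k1 => [[]|]; case: k2 => [[]|] // _;
    case: b; rewrite /= ?(xpair_eqE, jE, eqxx, andbF).
rewrite cN in n1 n2 *; left; exact: necklace_slide_outer.
Qed.

End Fixed.
End Necklace.

(** * Out-degrees in [Gamma] *)

Section OutDegree.
Variable n : nat.

Lemma card_edge (g : hgraph (2 * n) (6 * n)) : mate_ok g -> #|edge g| = 3 * n.
Proof.
move=> mg; apply: double_inj; rewrite -addnn.
have E : #|edge g| = #|[set h : 'I_(6 * n) | h < mate g h]|.
  by rewrite card_sub; apply: eq_card => h; rewrite inE.
(* The involution [mate] exchanges the smaller and the larger halves of the edges, so each kind
   makes up half of the half-edges. *)
have E' : #|[set h : 'I_(6 * n) | h < mate g h]| =
          #|~: [set h : 'I_(6 * n) | h < mate g h]|.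
  rewrite -(card_imset _ (can_inj (mateK mg))); apply: eq_card => h.
  rewrite -[h in LHS](mateK mg) mem_imset ?inE ?mateK //; last first.
    exact: can_inj (mateK mg).
  by have := mate_neq h mg; rewrite -val_eqE /=; lia.
have := cardsC [set h : 'I_(6 * n) | h < mate g h].
by rewrite -E' -E card_ord; lia.
Qed.

Lemma outdeg_Gamma (x : node (Gamma n)) : outdeg x = 6 * n.
Proof.
have -> : outdeg x = #|edge_move x|.
  pose f (y : edge_move x) : gamma_arc n := Tagged (fun x => edge_move x) y.
  have fI : injective f by move=> y y' /eqP; rewrite eq_Tagged => /eqP.
  rewrite -(card_imset _ fI); apply: eq_card => -[z y].
  rewrite inE /= /gamma_src /=; apply/eqP/imsetP; last first.
    by case=> y' _ /(congr1 tag).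
  move=> zx.
  by subst z; exists y.
have /and3P[mr _ _] := cgraph_wf (repr x).
by rewrite card_prod card_bool card_edge //; lia.
Qed.

End OutDegree.

(** * Arcs entering the class of the necklace *)

Section NecklaceBoundary.
Variable m : nat.
Local Open Scope quotient_scope.
Variables (g : cgraph m.+1) (phi : bead_vertex m -> 'I_(2 * m.+1)).
Variable (psi : bead_half m -> 'I_(6 * m.+1)).
Hypotheses (N : necklace g phi psi) (m0 : 0 < m).

Let c0 : node (Gamma m.+1) := \pi_(iso_class m.+1) g.

(** The results of moves on the necklace up to rotation. Codes naming no admissible exchange are
    kept, as only an upper bound on their number matters. *)
Definition slide_of_code (u : bool * option bool * option bool * option bool) :=
  let: (b, c, c1, c2) := u in
  let v := (GRing.zero, b) : bead_vertex m in
  swap_att g (psi (v, c1)) (psi ((bead_mate (v, c)).1, c2)).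

(** Undoing the move of the arc is a move on the necklace that leads back to the class of the
    source; rotation supplies the code. *)
Lemma arc_into_necklace (a : gamma_arc m.+1) :
  gamma_src a != c0 -> gamma_tgt a = c0 ->
  let r := repr (gamma_src a) in
  ~~ doubled r (att r (val (tagged a).1)) /\
  exists u, hiso r (slide_of_code u).
Proof.
case: a => x [e i]; rewrite /gamma_src /gamma_tgt /= => xc0 E.
set r := repr x; have /and3P[mr cr _] := cgraph_wf r.
have [L|ne] := eqVneq (att r (val e)) (att r (mate r (val e))).
  case/eqP: xc0; rewrite -E -[LHS]reprK; congr (\pi _).
  by apply: val_inj; rewrite /= /whitehead L eqxx.
have [p [q [sl W]]] := whitehead_slide i cr ne.
have /eqmodP/hisoP[s [t I]] := E.
rewrite cgval_cwhitehead W in I.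
have Ir := hisom_swap p q I; rewrite swap_attK in Ir.
have slg := hisom_slidable I (slidable_swap sl).
have Ir' : hisom r (swap_att g (t q) (t p)) s t by rewrite swap_attC.
(* The exchange leaves the edge itself in place, so the undoubled vertex of the necklace after the
   move is the one corresponding to the end of [e] in [r]. *)
have ate : att (swap_att g (t q) (t p)) (t (val e)) = att g (t (val e)).
  have [ne' q1 q2 p1 p2] := slg.
  rewrite att_swapD 1?eq_sym //.
  by apply: contraNneq ne' => tpe; rewrite -p1 tpe.
(* The other alternative would make the source isomorphic to the necklace. *)
have [U|H] := necklace_slide N m0 slg; last first.
  case/eqP: xc0; rewrite -[x]reprK; apply: pi_iso.
  apply: hiso_trans (hiso_symW H).
  by apply/hisoP; exists s, t.
split.
  by rewrite -(hisom_doubled _ Ir') -Ir'.1 ate.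
have [b [c [c1 [c2 H]]]] := necklace_slide_code N slg.
exists (b, c, c1, c2); apply: hiso_trans H.
by apply/hisoP; exists s, t.
Qed.

Lemma card_undoubled_class (r : cgraph m.+1) u : hiso r (slide_of_code u) ->
  #|[set h | ~~ doubled r (att r h)]| <= 12.
Proof.
case: u => [[[b c] c1] c2] /= H; have := hiso_wf H (cgraph_wf r).
set p := psi _ in H *; set q := psi _ in H *.
case/and3P=> _ cs _; have /hisoP[s [t I]] := H.
apply: leq_trans (card_undoubled_swap (necklace_mate_ok N) cs (necklace_doubled N)).
rewrite -(card_imset _ (@perm_inj _ t)); apply: subset_leq_card.
by apply/subsetP => _ /imsetP[h hd ->]; rewrite !inE I.1 (hisom_doubled _ I) in hd *.
Qed.

Lemma card_boundary_necklace : #|out_boundary (~: [set c0])| <= 54 * 24.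
Proof.
pose B := [set x : iso_class m.+1 |
  [exists u, hiso (repr x) (slide_of_code u)]].
have B54 : #|B| <= 54.
  have code x : exists u, x \in B -> hiso (repr x) (slide_of_code u).
    have [|] := boolP (x \in B); last by exists (false, None, None, None).
    by rewrite inE => /existsP[u H]; exists u.
  have [f fE] := choice code.
  (* Two classes with the same code have isomorphic representatives, hence coincide. *)
  have fI : {in B &, injective f}.
    move=> x y /fE Hx /fE Hy fxy; rewrite fxy in Hx.
    by rewrite -[x]reprK -[y]reprK; apply/pi_iso/(hiso_trans Hx)/hiso_symW.
  rewrite -(card_in_imset fI); apply: leq_trans (max_card _) _.
  by rewrite !card_prod !card_option card_bool.
apply: leq_trans (card_fiber_leq (f := @gamma_src m.+1) (B := B) (c := 24) _ _) _.
- move=> a; rewrite !inE negbK => /andP[s /eqP t].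
  by have [_ [u H]] := arc_into_necklace s t; apply/existsP; exists u.
- move=> x; rewrite inE => /existsP[u /card_undoubled_class H].
  set D := [set a in _ | _].
  (* An arc with given source is determined by its half-edge, one of at most 12 at undoubled
     vertices, and by one of two moves; this gives 24. *)
  pose f (a : gamma_arc m.+1) := (val (tagged a).1, (tagged a).2).
  have fI : {in D &, injective f}.
    move=> [y [e i]] [y' [e' i']]; rewrite !inE /gamma_src /=.
    move=> /andP[_ /eqP yx] /andP[_ /eqP y'x]; subst y y'.
    by case=> /val_inj -> ->.
  rewrite -(card_in_imset fI).
  apply: (@leq_trans (12 * #|[set: bool]|)); last by rewrite cardsT card_bool.
  apply: (@leq_trans
    #|setX [set h | ~~ doubled (repr x) (att (repr x) h)] [set: bool]|).
    apply: subset_leq_card; apply/subsetP => _ /imsetP[a aD ->].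
    move: aD; rewrite !inE negbK => /andP[/andP[s /eqP t] /eqP sx].
    by have [U _] := arc_into_necklace s t; rewrite andbT /f /= -sx.
  by rewrite cardsX leq_mul2r H orbT.
- by rewrite leq_mul2r B54 orbT.
Qed.

(** An exchange across an edge between two beads destroys the double edge at one end. This makes the
    complement of [c0] nonempty, as a cut requires. *)
Lemma necklace_other_class : exists x, x != c0.
Proof.
have /and3P[mg cg _] := cgraph_wf g.
have jz := GRing.zero : 'I_m.+1.
pose v := (jz, false) : bead_vertex m.
pose e := psi (v, None).
pose p := psi (v, Some true); pose q := psi ((bead_mate (v, None)).1, Some true).
have [[phi' phiK _] bpsi aE mE] := N.
have sl : slidable g e p q.
  split; rewrite ?mE ?aE //= ?(inj_eq (bij_inj bpsi)) ?(inj_eq (can_inj phiK)) //;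
    by rewrite /= xpair_eqE andbF.
have [g' Eg' _] := linked_slide sl.
exists (\pi g'); apply/eqP => /eqmodP/hisoP[s [t I]].
have /negP[] := necklace_slide_outer N jz false
  (c1 := Some true) (c2 := Some true) m0 isT isT.
by rewrite -Eg' -(hisom_doubled _ I) (necklace_doubled N).
Qed.

End NecklaceBoundary.

(** * The bound on the conductance and its limit *)

Lemma set_conductance_ge0 (R : realType) (G : dimultigraph) (S : {set node G}) :
  (0 <= set_conductance R S)%R.
Proof. by rewrite divr_ge0. Qed.

Lemma conductance_ge0 (R : realType) (G : dimultigraph) :
  (0 <= conductance R G)%E.
Proof.
by apply: le_bigmin => // S _; rewrite lee_fin set_conductance_ge0.
Qed.

Lemma conductance_Gamma (R : realType) m : 0 < m ->
  (conductance R (Gamma m.+1) <= (216 * m.+1%:R^-1)%R%:E)%E.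
Proof.
move=> m0; have [g0 [phi [psi N0]]] := necklace_exists m.
pose g : cgraph m.+1 := CGraph (necklace_wf N0).
have N : necklace g phi psi by [].
have [x xc] := necklace_other_class N m0.
have := card_boundary_necklace N m0.
set c0 : node (Gamma m.+1) := \pi_(iso_class m.+1)%qT g in xc *.
set S := ~: [set c0] => B.
have xS : x \in S by rewrite !inE.
apply: (bigmin_inf S).
  apply/andP; split; first by apply/set0Pn; exists x.
  by apply/eqP => /setP/(_ c0); rewrite !inE eqxx.
rewrite lee_fin /set_conductance setCK.
have V1 : outvol [set c0] = 6 * m.+1 by rewrite /outvol big_set1 outdeg_Gamma.
have V2 : 6 * m.+1 <= outvol S.
  by rewrite /outvol (bigD1 x) //= outdeg_Gamma leq_addr.
(* The smaller volume is that of [c0], namely [6 * m.+1], and the numerator satisfies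
   [54 * 24 = 216 * 6]. *)
rewrite V1 (minn_idPr V2) natrM invfM mulrA.
rewrite ler_pM2r ?invr_gt0 ?ltr0n // ler_pdivrMr ?ltr0n // -natrM ler_nat.
exact: leq_trans B _.
Qed.

Local Open Scope classical_set_scope.

Theorem theorem2p2 (R : realType) :
  [/\ forall n : nat, (1 <= n)%N -> di_connected (Gamma n),
      conductance R (Gamma n) @[n --> \oo] --> 0%E
    & ~ outer_expander_family R (fun n : nat => Gamma n.+1)].
Proof.
(* The bound concerns index [n.+1], so the shifted sequence is squeezed between [0] and a multiple
   of the harmonic sequence. *)
have lim1 : conductance R (Gamma n.+1) @[n --> \oo] --> 0%E.
  apply: (@squeeze_cvge _ _ _ _ (fun=> 0%E) _ (fun n => (216 * n.+1%:R^-1)%R%:E)).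
  - near=> n; rewrite conductance_ge0 /=; apply: conductance_Gamma.
    by near: n; exact: nbhs_infty_gt.
  - exact: cvg_cst.
  - apply: cvg_EFin; first exact: nearW.
    have := cvgM (@cvg_cst _ (216%R : R) _ \oo _) (@cvg_harmonic R).
    by rewrite mulr0; apply.
split=> [n n1||[c c0 H]].
- split; last exact: Gamma_connected.
  case: n n1 => // m _; have [g0 [phi [psi N]]] := necklace_exists m.
  by apply/card_gt0P; exists (\pi_(iso_class m.+1)%qT (CGraph (necklace_wf N))).
- by rewrite -(@cvg_shiftS _ (fun n => conductance R (Gamma n))).
(* A uniform lower bound passes to the limit [0]. *)
- have : (c%:E <= 0)%E by apply: (cvge_ge _ lim1); exact: nearW.
  by rewrite lee_fin leNgt c0.
Unshelve. all: by end_near.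
Qed.
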